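(* Let $(X,\tau)$ be a Hausdorff topological space. Let $\{C_i\}_{i=1}^{\infty}$ be a sequence of closed nested nonempty subsets of $X$ (that is, $C_{i+1}\subseteq C_i$ for all $i$). If for every open cover $\gamma$ of $X$ there exist $U\in\gamma$ and $j_0\in\mathbb{N}$ such that $C_{j_0}\subseteq U$, then there exists $\bar{x}\in X$ such that $\bigcap_{i=1}^{\infty}C_i=\{\bar{x}\}$. *)

(* Defs.v *)
From mathcomp Require Import all_boot all_classical.
From mathcomp Require Import topology.

Set Implicit Arguments.
Unset Strict Implicit.
Unset Printing Implicit Defensive.

Local Open Scope classical_set_scope.

Definition open_cover (X : topologicalType) (gamma : set (set X)) : Prop :=
  gamma `<=` open /\ \bigcup_(U in gamma) U = [set: X].

(* Main.v *)
(** The complements of the [C i] cannot cover [X], since nestedness forbids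
    [C j `<=` ~` C i]; so the [C i] have a common point. If [x != y] were two
    common points, the complements of [[set x]] and [[set y]] would form an open
    cover (points are closed), neither member of which contains any [C j]. *)
Require Import Defs.
From mathcomp Require Import all_boot all_classical.
From mathcomp Require Import topology.

Local Open Scope classical_set_scope.

Theorem corollary2p7 (X : topologicalType) (hX : hausdorff_space X)
    (C : nat -> set X)
    (C_closed : forall i, closed (C i))
    (C_nonempty : forall i, C i !=set0)
    (C_nested : forall i, C i.+1 `<=` C i)
    (C_cover : forall gamma : set (set X), open_cover gamma ->
       exists U : set X, gamma U /\ exists j0 : nat, C j0 `<=` U) :
  exists xbar : X, \bigcap_i C i = [set xbar].
Proof.
have C_anti i j : (i <= j)%N -> C j `<=` C i.
  (* Writing [j] as [(j - i) + i] turns the claim into an induction on the gap. *)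
  move=> /subnK <-; elim: (j - i)%N => [//|n IHn].
  by rewrite addSn; exact: subset_trans (C_nested _) IHn.
have [x Cx] : \bigcap_i C i !=set0.
  apply/set0P/eqP => C0.
  have [|_ [[i _ <-] [j CjNCi]]] := C_cover (range (fun i => ~` C i)).
    split; first by move=> _ [i _ <-]; exact: closed_openC.
    by rewrite bigcup_image -setC_bigcap C0 setC0.
  (* At index [maxn i j] the set lies in both [C i] and [C j], so [z] contradicts the inclusion of
     [C j] in the complement of [C i]. *)
  have [z Cz] := C_nonempty (maxn i j).
  apply: (CjNCi z); apply: C_anti Cz.
  - exact: leq_maxr.
  - exact: leq_maxl.
exists x; apply/seteqP; split => [y Cy|_ -> //].
apply: contrapT => /= yNx.
have closed1 (z : X) : closed [set z].
  exact/accessible_closed_set1/hausdorff_accessible.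
have [|U [UE [j CjU]]] := C_cover [set ~` [set x]; ~` [set y]].
  split; first by move=> _ [->|->]; exact: closed_openC.
  (* By De Morgan the union is the complement of the intersection of the two singletons, empty since
     [x] differs from [y]. *)
  by rewrite bigcup_setU !bigcup_set1 -setCI set1I memNset ?setC0//; apply/nesym.
case: UE CjU => -> CjU.
- exact: (CjU x (Cx j I)).
- exact: (CjU y (Cy j I)).
Qed.
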